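(* Let $n$ be a positive integer and let $G$ be a simple graph. Then $G$ is isomorphic to the friendship graph $F_n$ if and only if $$[x]\,da(G;x,y) = 2n\,y^{2n-1} +y.$$
   Context: All graphs are finite, simple and have at least one vertex. For a graph $G$, $S\subseteq V(G)$ and $u\in V(G)$, let $\bar S=V(G)\setminus S$, let $\delta_S(u)=|\{v\in S:\{u,v\}\in E(G)\}|$, and let $G[S]$ be the subgraph induced by $S$. The defensive alliance polynomial of $G$ is $$da(G;x,y)=\sum_{S} x^{|S|}\,y^{f_y(S)},\qquad f_y(S)=\min_{u\in S}\bigl(\delta_S(u)-\delta_{\bar S}(u)+|V(G)|\bigr),$$ where the sum runs over all non-empty $S\subseteq V(G)$ such that $G[S]$ is connected (single-vertex graphs are connected). $[x^k]\,da(G;x,y)$ denotes the coefficient of $x^k$ in $da(G;x,y)$, which is a polynomial in $y$. The friendship graph $F_n$ is the graph join $nK_2+K_1$, i.e. the disjoint union of $n$ copies of $K_2$ together with one extra vertex adjacent to all other vertices (so it has $2n+1$ vertices). *)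

(* Defs.v *)
From HB Require Import structures.
From mathcomp Require Import all_boot all_order all_algebra.

Set Implicit Arguments.
Unset Strict Implicit.
Unset Printing Implicit Defensive.

Import Order.TTheory GRing.Theory Num.Theory.

(* Finite simple graphs.  The vertex type may be empty here; nonemptiness is
   a separate hypothesis where it is needed. *)
Record sgraph := SGraph {
  vertex :> finType;
  adj : rel vertex;
  adj_sym : symmetric adj;
  adj_irr : irreflexive adj
}.

Definition isomorphic (G H : sgraph) : Prop :=
  exists2 f : G -> H, bijective f & forall u v : G, adj (f u) (f v) = adj u v.

Section Induced.
Variables (G : sgraph) (S : {set G}).

Definition induced_adj : rel {u : G | u \in S} :=
  fun u v => adj (val u) (val v).

Lemma induced_adj_sym : symmetric induced_adj.
Proof. by move=> u v; apply: adj_sym. Qed.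

Lemma induced_adj_irr : irreflexive induced_adj.
Proof. by move=> u; apply: adj_irr. Qed.

Definition induced : sgraph := SGraph induced_adj_sym induced_adj_irr.
End Induced.

Definition connected (G : sgraph) : bool :=
  [forall u : G, forall v : G, connect (@adj G) u v].

Section Complete.
Variable m : nat.

Definition complete_adj : rel 'I_m := fun i j => i != j.

Lemma complete_adj_sym : symmetric complete_adj.
Proof. by move=> i j; rewrite /complete_adj eq_sym. Qed.

Lemma complete_adj_irr : irreflexive complete_adj.
Proof. by move=> i; rewrite /complete_adj eqxx. Qed.

Definition complete : sgraph := SGraph complete_adj_sym complete_adj_irr.
End Complete.

(* Disjoint union of n copies of G: the first component is the copy index. *)
Section Copies.
Variables (n : nat) (G : sgraph).

Definition copies_adj : rel ('I_n * G)%type :=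
  fun p q => (p.1 == q.1) && adj p.2 q.2.

Lemma copies_adj_sym : symmetric copies_adj.
Proof. by move=> p q; rewrite /copies_adj eq_sym adj_sym. Qed.

Lemma copies_adj_irr : irreflexive copies_adj.
Proof. by move=> p; rewrite /copies_adj adj_irr andbF. Qed.

Definition copies : sgraph := SGraph copies_adj_sym copies_adj_irr.
End Copies.

Section Join.
Variables G H : sgraph.

Definition join_adj : rel (G + H)%type := fun p q =>
  match p, q with
  | inl u, inl v => adj u v
  | inr u, inr v => adj u v
  | _, _ => true
  end.

Lemma join_adj_sym : symmetric join_adj.
Proof. by move=> [u|u] [v|v] //=; apply: adj_sym. Qed.

Lemma join_adj_irr : irreflexive join_adj.
Proof. by move=> [u|u] /=; apply: adj_irr. Qed.

Definition join : sgraph := SGraph join_adj_sym join_adj_irr.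
End Join.

Definition friendship (n : nat) : sgraph :=
  join (copies n (complete 2)) (complete 1).

Section AlliancePolynomial.
Variable G : sgraph.
Implicit Types (S : {set G}) (u : G).

Definition delta S u : nat := #|[set v in S | adj u v]|.

(* Natural-number form of delta_S(u) - delta_{~S}(u) + |V|; adding |V| first
   makes the truncated subtraction exact (alliance_valE). *)
Definition alliance_val S u : nat := (delta S u + #|G|) - delta (~: S) u.

Lemma alliance_valE S u :
  ((alliance_val S u)%:Z = (delta S u)%:Z - (delta (~: S) u)%:Z + #|G|%:Z)%R.
Proof.
have le : delta (~: S) u <= delta S u + #|G|.
  by apply: leq_trans (leq_addl _ _); apply: max_card.
by rewrite /alliance_val -(subzn le) PoszD addrAC.
Qed.

(* alliance_val S u <= 2|V| always, so the default value 2|V| is harmless: for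
   nonempty S this is the true minimum (f_yP). *)
Definition f_y S : nat := \big[minn/(#|G|).*2]_(u in S) alliance_val S u.

Lemma alliance_val_le S u : alliance_val S u <= (#|G|).*2.
Proof.
by apply: leq_trans (leq_subr _ _) _; rewrite -addnn leq_add2r max_card.
Qed.

Lemma f_yP S : S != set0 ->
  (exists2 u, u \in S & f_y S = alliance_val S u) /\
  {in S, forall u, f_y S <= alliance_val S u}.
Proof.
case/set0Pn=> u0 Su0.
have lb u : u \in S -> f_y S <= alliance_val S u.
  move=> Su; rewrite /f_y; elim: (index_enum G) (mem_index_enum u) => //= v r IH.
  rewrite inE big_cons => /predU1P[<-|/IH le]; first by rewrite Su geq_minl.
  by case: ifP => // _; apply: leq_trans (geq_minr _ _) le.
split=> //.
have [//|e] : (exists2 u, u \in S & f_y S = alliance_val S u) \/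
              f_y S = (#|G|).*2.
  rewrite /f_y; elim/big_ind: _ => [|x y hx hy|u Su]; first by right.
    by rewrite /minn; case: ifP.
  by left; exists u.
exists u0 => //; apply/eqP; rewrite eqn_leq lb //= e.
exact: alliance_val_le.
Qed.

Local Open Scope ring_scope.

(* The outer variable is x and the inner one is y, so the coefficient of x^k,
   (da G)`_k, is a polynomial in y. *)
Definition da : {poly {poly int}} :=
  \sum_(S : {set G} | (S != set0) && connected (induced S))
     ('X^(f_y S))%:P * 'X^#|S|.
End AlliancePolynomial.

(* Main.v *)
Require Import Defs.
From HB Require Import structures.
From mathcomp Require Import all_boot all_order all_algebra.
From mathcomp Require Import zify.

(** The coefficient of x is the sum of y^(|V| - deg u) over the vertices u, so
    it determines the degree sequence. For 2n y^(2n-1) + y this means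
    |V| = 2n+1, a vertex c adjacent to all others, and degree 2 elsewhere:
    deleting c leaves a perfect matching. *)

Set Implicit Arguments.
Unset Strict Implicit.
Unset Printing Implicit Defensive.

Import Order.TTheory GRing.Theory Num.Theory.
Local Open Scope ring_scope.

Definition deg (G : sgraph) (u : G) : nat := #|[set v | adj u v]|.

Lemma deg_lt (G : sgraph) (u : G) : (deg u < #|G|)%N.
Proof.
rewrite -cardsT; apply: proper_card; apply/properP; split; first exact: subsetT.
by exists u; rewrite ?inE ?adj_irr.
Qed.

Lemma connected_induced1 (G : sgraph) (u : G) : connected (induced [set u]).
Proof.
apply/forallP=> -[x xu]; apply/forallP=> -[y yu].
have -> : exist (fun u0 => u0 \in [set u]) x xu = exist _ y yu.
  by apply: val_inj => /=; move: (xu) (yu) => /set1P-> /set1P->.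
exact: connect0.
Qed.

(** The minimum is over [u] alone. By irreflexivity [u] has no neighbour inside [[set u]], so all
    [deg u] of them are counted outside. *)
Lemma f_y1 (G : sgraph) (u : G) : f_y [set u] = (#|G| - deg u)%N.
Proof.
have /f_yP[[v /set1P-> ->] _] : [set u] != set0.
  by apply/set0Pn; exists u; rewrite set11.
rewrite /alliance_val /delta /deg.
have -> : [set v in [set u] | adj u v] = set0.
  by apply/setP=> w; rewrite !inE; case: eqP => // ->; rewrite adj_irr.
rewrite cards0 add0n; congr (_ - #|pred_of_set _|)%N.
by apply/setP=> w; rewrite !inE; case: eqP => // ->; rewrite adj_irr.
Qed.

(** Only sets of size one contribute to this coefficient, and every singleton induces a connected
    graph. *)
Lemma coef1_da (G : sgraph) : (da G)`_1 = \sum_(u : G) 'X^(#|G| - deg u).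
Proof.
rewrite /da coef_sum.
under eq_bigr => S _ do rewrite coefCM coefXn mulr_natr mulrb eq_sym.
rewrite -big_mkcondr /=.
rewrite (eq_bigl (fun S => S \in [set [set u] | u in G])); last first.
  move=> S; apply/idP/imsetP => [/andP[_ /cards1P[u ->]]|[u _ ->]].
    by exists u.
  by rewrite cards1 connected_induced1 -card_gt0 cards1.
rewrite big_imset /=; last by move=> u v _ _; apply: set1_inj.
by apply: eq_bigr => u _; rewrite f_y1.
Qed.

Lemma coef_coef1_da (G : sgraph) k :
  (da G)`_1`_k = #|[set u : G | #|G| - deg u == k]|%N%:R.
Proof.
rewrite coef1_da coef_sum -sum1dep_card natr_sum [RHS]big_mkcond /=.
by apply: eq_bigr => u _; rewrite coefXn eq_sym; case: eqP.
Qed.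

(** Isomorphisms preserve order and degrees; this reduces the forward direction to computing with
    [friendship n] itself. *)
Lemma isomorphic_coef1_da (G H : sgraph) :
  isomorphic G H -> (da G)`_1 = (da H)`_1.
Proof.
case=> f bf fadj; rewrite !coef1_da (reindex f) /=; last exact: onW_bij.
rewrite -(bij_eq_card bf); apply: eq_bigr => u _; congr ('X^(_ - _)).
rewrite /deg -(card_imset _ (bij_inj bf)); congr #|pred_of_set _|.
case: (bf) => g fK gK; apply/setP=> v; rewrite inE.
apply/imsetP/idP => [[w]|uv]; first by rewrite inE => uw ->; rewrite fadj.
by exists (g v); rewrite ?gK // inE -fadj gK.
Qed.

Lemma card_friendship n : #|friendship n| = (2 * n).+1.
Proof. by rewrite card_sum card_prod !card_ord; lia. Qed.

Lemma deg_friendship_inl n (p : 'I_n * 'I_2) :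
  deg (inl p : friendship n) = 2%N.
Proof.
case: p => i j; rewrite /deg.
(* On ['I_2], [rev_ord] swaps the two elements, so the neighbours are the partner in copy [i] and
   the hub. *)
have -> : [set v | @adj (friendship n) (inl (i, j)) v]
          = [set inl (i, rev_ord j); inr ord0].
  apply/setP=> -[[i' j']|z]; rewrite !inE /= ?(ord1 z) ?eqxx ?orbT //.
  rewrite /copies_adj /= /complete_adj orbF (inj_eq inl_inj) xpair_eqE eq_sym.
  congr (_ && _); case: j j' => [[|[|[]]]] // hj [[|[|[]]]] // hj';
  by rewrite -!val_eqE.
by rewrite cards2.
Qed.

Lemma deg_friendship_inr n (z : 'I_1) :
  deg (inr z : friendship n) = (2 * n)%N.
Proof.
rewrite /deg; have -> : [set v | @adj (friendship n) (inr z) v] = ~: [set inr z].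
  by apply/setP=> -[p|t]; rewrite !inE //= /complete_adj !ord1 eqxx.
by rewrite cardsC1 card_friendship.
Qed.

Lemma coef1_da_friendship n :
  (da (friendship n))`_1 = (2 * n)%N%:R *: 'X^(2 * n - 1) + 'X.
Proof.
rewrite coef1_da big_sumType /= big_ord1 deg_friendship_inr card_friendship.
rewrite subSnn expr1; congr (_ + _).
under eq_bigr => p _ do rewrite deg_friendship_inl.
by rewrite sumr_const card_prod !card_ord mulnC scaler_nat subSS.
Qed.

Section Involution.
Variables (T : finType) (A : {set T}) (m : T -> T).
Hypotheses (mA : {in A, forall u, m u \in A})
           (mK : {in A, forall u, m (m u) = u})
           (mN : {in A, forall u, m u != u}).

Lemma involution_transversal :
  exists R : {set T}, [/\ R \subset A, #|A| = (2 * #|R|)%N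
                        & {in A, forall u, (m u \in R) = (u \notin R)}].
Proof.
(* Each orbit [{u, m u}] has two elements; [R] keeps the one enumerated first. *)
pose R := [set u in A | enum_rank u < enum_rank (m u)]%N.
have RA : R \subset A by apply/subsetP=> u; rewrite inE => /andP[].
have mR : {in A, forall u, (m u \in R) = (u \notin R)}.
  move=> u Au; rewrite !inE Au mA // mK //= -leqNgt ltn_neqAle.
  by rewrite val_eqE (inj_eq enum_rank_inj) mN.
(* [A] splits into [R] and [A :\: R], and the latter is the injective image of [R] under [m]. *)
exists R; split=> //; rewrite -(cardsID R A) (setIidPr RA) mul2n -addnn.
congr (_ + _)%N; rewrite -[in RHS](card_in_imset (f := m) (D := R)); last first.
  move=> u v /(subsetP RA) Au /(subsetP RA) Av e.
  by rewrite -(mK Au) e mK.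
congr #|pred_of_set _|; apply/setP=> u; rewrite inE.
apply/andP/imsetP => [[uR Au]|[v vR ->]].
  by exists (m u); rewrite ?mK // mR.
have Av := subsetP RA v vR.
by rewrite mA // mR // vR.
Qed.

End Involution.

Section Recognition.
Variables (n : nat) (G : sgraph) (c : G).
Hypotheses (n_gt0 : (0 < n)%N) (cardG : #|G| = (2 * n).+1)
           (adj_c : forall v, adj c v = (v != c))
           (deg2 : forall u, u != c -> deg u = 2%N).

(** A vertex other than [c] has two neighbours, one of which is [c], so exactly one neighbour
    remains. *)
Lemma matching_off_center : exists m : G -> G,
  forall u v, u != c -> v != c -> adj u v = (v == m u).
Proof.
exists (fun u => odflt c [pick w | (w != c) && adj u w]) => u v uc vc.
have /cards1P[w e] : #|[set v | adj u v] :\ c| == 1%N.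
  have := cardsD1 c [set v | adj u v].
  by rewrite -/(deg u) deg2 // inE adj_sym adj_c uc add1n => -[<-].
have wE x : (x != c) && adj u x = (x == w).
  by move/setP/(_ x): e; rewrite !inE.
(* The pick succeeds because [w] qualifies, so the default [c] is never returned here. *)
case: pickP => [x|/(_ w)]; rewrite wE ?eqxx // => /eqP->.
by rewrite -wE vc.
Qed.

(** The matching [m] pairs up the vertices other than [c], and [R] selects one from each pair. Such
    a vertex is sent to the index of its pair together with a bit for membership in [R]; [c] is sent
    to the hub. *)
Lemma isomorphic_friendship : isomorphic G (friendship n).
Proof.
have [m mE] := matching_off_center.
pose A := ~: [set c].
have AE u : (u \in A) = (u != c) by rewrite !inE.
have mA : {in A, forall u, m u \in A}.
  move=> u; rewrite !AE => uc; apply/eqP => mc.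
  (* If [m u] were [c], then [c] would be the only neighbour of [u]. *)
  have : deg u = 1%N.
    rewrite /deg; apply/eqP/cards1P; exists c; apply/setP=> v; rewrite !inE.
    have [->|vc] := eqVneq v c; first by rewrite adj_sym adj_c.
    by rewrite mE // mc (negbTE vc).
  by rewrite deg2.
have adj_m u : u \in A -> adj u (m u).
  by move=> Au; rewrite mE -?AE ?mA.
have mK : {in A, forall u, m (m u) = u}.
  move=> u Au; apply/esym/eqP.
  by rewrite -mE -?AE ?mA // adj_sym adj_m.
have mN : {in A, forall u, m u != u}.
  by move=> u Au; apply/eqP=> e; have := adj_m u Au; rewrite e adj_irr.
have [R [RA cardA mR]] := involution_transversal mA mK mN.
have cardR : #|R| = n by move: cardA; rewrite cardsC1 cardG /=; lia.
(* A successor is needed for [inord] to land in ['I_k.+1]. *)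
case: n n_gt0 cardG cardR => // k _ cG cR.
pose rep u := if u \in R then u else m u.
have repR u : u \in A -> rep u \in R.
  by rewrite /rep => Au; case: ifPn => // uR; rewrite mR.
pose idx u : 'I_k.+1 := inord (index (rep u) (enum R)).
have idxE u v : u \in A -> v \in A -> (idx u == idx v) = (rep u == rep v).
  move=> Au Av; apply/eqP/eqP => [/(congr1 val)|]; last by rewrite /idx => ->.
  have lt w : w \in A -> (index (rep w) (enum R) < k.+1)%N.
    by move=> Aw; rewrite -cR cardE index_mem mem_enum repR.
  rewrite /= !inordK ?lt //.
  by apply: (index_inj c (s := enum R)); rewrite mem_enum repR.
pose bit u : 'I_2 := inord (u \in R).
have bitE u v : (bit u == bit v) = ((u \in R) == (v \in R)).
  by rewrite -val_eqE /= !inordK; do 2?case: (_ \in R).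
pose f u : friendship k.+1 := if u == c then inr ord0 else inl (idx u, bit u).
have f_inj : injective f.
  move=> u v; rewrite /f.
  have [->|uc] := eqVneq u c; have [->|vc] := eqVneq v c => //.
  move: uc vc; rewrite -!AE => Au Av [/eqP + /eqP].
  rewrite idxE // bitE /rep => /eqP + /eqP e; rewrite e.
  by case: ifP => // _ e'; rewrite -(mK u) // e' mK.
(* Both graphs have [2n + 1] vertices, so injectivity gives bijectivity. *)
exists f; first by apply: inj_card_bij => //; rewrite card_friendship cG.
move=> u v; rewrite /f.
have [->|uc] := eqVneq u c; have [->|vc] := eqVneq v c.
- by rewrite !adj_irr.
- by rewrite adj_c vc.
- by rewrite [RHS]adj_sym adj_c uc.
rewrite /= /copies_adj /= /complete_adj mE //.
move: uc vc; rewrite -!AE => Au Av; rewrite idxE // bitE /rep.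
(* Since [m] exchanges [R] with the rest of [A], matched vertices have different bits. When the bits
   differ, sharing a representative means being matched. *)
have [uR|uR] := boolP (u \in R); have [vR|vR] := boolP (v \in R) => /=;
  rewrite ?andbF ?andbT.
- by apply/esym/eqP => e; move: vR; rewrite e mR ?uR.
- by apply/eqP/eqP => ->; rewrite mK.
- exact: eq_sym.
- by apply/esym/eqP => e; move: vR; rewrite e mR ?uR.
Qed.

End Recognition.

Theorem proposition36 (n : nat) (hn : (0 < n)%N) (G : sgraph)
    (hG : (0 < #|G|)%N) :
  isomorphic G (friendship n) <->
  (da G)`_1 = (2 * n)%N%:R *: 'X^(2 * n - 1) + 'X.
Proof.
split=> [/isomorphic_coef1_da->|e]; first exact: coef1_da_friendship.
have cardG : #|G| = (2 * n).+1.
  (* At [y = 1] each vertex contributes 1, so the left side becomes the order of [G]. *)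
  have := congr1 (fun p => p.[1]) e.
  rewrite /= coef1_da horner_sum.
  under eq_bigr => u _ do rewrite hornerXn expr1n.
  rewrite sumr_const hornerD hornerZ hornerXn hornerX expr1n mulr1 natr1.
  by move/eqP; rewrite eqr_nat => /eqP.
(* The two terms are added because the exponents [2n - 1] and [1] coincide when [n = 1]. *)
have count (k : nat) : #|[set u : G | #|G| - deg u == k]|%N
    = ((2 * n) * (k == 2 * n - 1) + (k == 1))%N.
  apply/eqP; rewrite -(eqr_nat int) -coef_coef1_da e coefD coefZ coefXn coefX.
  by rewrite natrD (natrM _ (2 * n)%N).
have /card_gt0P[c] : (0 < #|[set u : G | #|G| - deg u == 1]|)%N.
  by rewrite count addn1.
rewrite inE => /eqP dc.
have deg2 u : u != c -> deg u = 2%N.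
  move=> uc; have lt := deg_lt u.
  have : (0 < #|[set v : G | #|G| - deg v == #|G| - deg u]|)%N.
    by apply/card_gt0P; exists u; rewrite inE.
  rewrite count => pos.
  (* For [n = 1] the only exponent is 1 and the order is 3, so every degree is 2. Otherwise exponent
     1 occurs only once, at [c], which forces exponent [2n - 1] at [u]. *)
  have [n1|n1] := eqVneq n 1%N; first by move: pos; lia.
  have du : (#|G| - deg u != 1)%N.
    apply/eqP=> du; have : (1 < #|[set v : G | #|G| - deg v == 1]|)%N.
      by apply/card_gt1P; exists u, c; rewrite !inE du dc.
    by rewrite count; lia.
  by move: pos; lia.
apply: (isomorphic_friendship (c := c)) => // v.
(* By [dc], [c] has degree [2n], the size of the complement of [[set c]], so inclusion is enough. *)
have : [set v | adj c v] = ~: [set c].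
  apply/eqP; rewrite eqEcard cardsC1 -/(deg c); apply/andP; split; last by lia.
  by apply/subsetP=> w; rewrite !inE; apply: contraTneq => ->; rewrite adj_irr.
by move/setP/(_ v); rewrite !inE.
Qed.
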